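(* Let $g\ge2$. Every cone type of a nonidentity element of $\Gamma_g$ equals $\mathcal C(z)$ for some element $z$ represented by a nonempty subword of length at most $2g$ of a cyclic permutation of $[a_1,b_1]\cdots[a_g,b_g]$ or of its inverse $[b_g,a_g]\cdots[b_1,a_1]$; there are exactly $8g(2g-1)$ such cone types. Hence $\Gamma_g$ has exactly $8g(2g-1)+1$ cone types (including $\mathcal C(e)$).
   Context: $\Gamma_g=\langle a_1,\dots,a_g,b_1,\dots,b_g\mid [a_1,b_1]\cdots[a_g,b_g]\rangle$ with $[a,b]=aba^{-1}b^{-1}$, the fundamental group of a closed orientable surface of genus $g$, with symmetric generating set $\{a_i^{\pm1},b_i^{\pm1}\}$ and word length $|\cdot|$. The cone type of $x$ is $\mathcal C(x)=\{z\in\Gamma_g:\ |xz|=|x|+|z|\}$. *)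

(* Defs.v *)
(* Surface group Gamma_g given by its presentation; elements
   are represented by words in the generators, with equality in the group
   being the equivalence relation generated by inserting a trivial pair
   x x^-1 or the relator anywhere in a word. *)
From mathcomp Require Import all_boot.
From Stdlib Require Import Relations ClassicalEpsilon.
Set Implicit Arguments. Unset Strict Implicit. Unset Printing Implicit Defensive.

(* A letter (i, isb, inv): generator a_{i+1} (isb = false) or b_{i+1}
   (isb = true), inverted iff inv = true. *)
Definition letter (g : nat) : finType := ('I_g * bool * bool)%type.
Definition word (g : nat) := seq (letter g).

Definition linv g (x : letter g) : letter g := (x.1.1, x.1.2, ~~ x.2).
Definition winv g (w : word g) : word g := rev (map (@linv g) w).

Definition gen_a g (i : 'I_g) : letter g := (i, false, false).
Definition gen_b g (i : 'I_g) : letter g := (i, true, false).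

Definition commw g (i : 'I_g) : word g :=
  [:: gen_a i; gen_b i; linv (gen_a i); linv (gen_b i)].

Definition relator g : word g := flatten [seq commw i | i <- enum 'I_g].

Inductive step g : word g -> word g -> Prop :=
| step_free (u v : word g) (x : letter g) : step (u ++ v) (u ++ [:: x; linv x] ++ v)
| step_rel (u v : word g) : step (u ++ v) (u ++ relator g ++ v).

Definition eqw g : relation (word g) := clos_refl_sym_trans _ (@step g).

Definition is_len g (w : word g) (n : nat) : Prop :=
  (exists w', eqw w' w /\ size w' = n) /\ (forall w', eqw w' w -> n <= size w').

Definition wlen g (w : word g) : nat :=
  epsilon (inhabits 0) (fun n => is_len w n).

Definition in_cone g (x z : word g) : Prop := wlen (x ++ z) = wlen x + wlen z.

(* C(x) = C(y) (cone types as subsets of Gamma_g; every element is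
   represented by some word z) *)
Definition same_cone g (x y : word g) : Prop := forall z, in_cone x z <-> in_cone y z.

Definition candidate g (z : word g) : Prop :=
  0 < size z <= 2 * g /\
  exists k, k < 4 * g /\ (infix z (rot k (relator g)) \/ infix z (rot k (winv (relator g)))).

Definition cone_distinct g (s : seq (word g)) : Prop :=
  forall i j, i < size s -> j < size s ->
    same_cone (nth [::] s i) (nth [::] s j) -> i = j.

(* Main.v *)
(* A vertex of the Cayley graph is described by the edges leading closer to the
   identity and by its heights in the two polygons along such an edge; this type
   determines the letters that lead away from the identity and the types they
   lead to.  Words accepted by the resulting automaton along leftmost edges are
   taken as vertices, letters act on them, and every polygon closes up, because
   a loop can be rotated to a strictly lower vertex until it starts at the bottom
   of the polygon.  Hence words act through the group, the orbit of the identity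
   computes the word length, and the cone type of an element is the set of words
   accepted from its type.  Types are separated by their descending letters and
   by how far one can climb along either adjacent polygon. *)
Require Import Defs.
From mathcomp Require Import all_boot.
From mathcomp Require Import zify.
From Stdlib Require Import Relations ClassicalEpsilon.
Set Implicit Arguments. Unset Strict Implicit. Unset Printing Implicit Defensive.

Section SurfaceGroup.
Variable g : nat.
Hypothesis hg : 2 <= g.
Local Notation letter := (letter g).
Local Notation word := (word g).
Local Notation h := (2 * g).
Implicit Types (x y c d : letter) (w u v B : word) (n k : nat).

(** * The cyclic order of the letters *)

Definition nxt x : letter :=
  let: (i, isb, iv) := x in
  if ~~ isb then (i, true, iv)
  else if ~~ iv then (i, false, true) else (ordS i, false, false).

Definition prv x : letter :=
  let: (i, isb, iv) := x in
  if isb then (i, false, iv)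
  else if iv then (i, true, false) else (ord_pred i, true, true).

(* The edges leaving a vertex [x] and [rho x] are consecutive sides of the
   polygon lying to the left of [x]. *)
Definition rho x : letter := linv (prv x).
Definition rhoi x : letter := nxt (linv x).
(* successor in the inverse of the relator *)
Definition nxr x : letter := rho (linv x).

Lemma linvK : involutive (@linv g).
Proof. by move=> [[i a] b]; rewrite /linv /= negbK. Qed.

Lemma linv_inj : injective (@linv g). Proof. exact: can_inj linvK. Qed.

Lemma nxtK : cancel nxt prv.
Proof. by move=> [[i []] []] //=; rewrite ordSK. Qed.

Lemma prvK : cancel prv nxt.
Proof. by move=> [[i []] []] //=; rewrite ord_predK. Qed.

Lemma rhoK : cancel rho rhoi.
Proof. by move=> x; rewrite /rho /rhoi linvK prvK. Qed.

Lemma rhoiK : cancel rhoi rho.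
Proof. by move=> x; rewrite /rho /rhoi nxtK linvK. Qed.

Lemma nxtE x : nxt x = rhoi (linv x).
Proof. by rewrite /rhoi linvK. Qed.

Lemma eq_rhoi x y : (x == rhoi y) = (rho x == y).
Proof. by apply/eqP/eqP => [->|<-]; rewrite ?rhoiK ?rhoK. Qed.

Lemma rhoi_eq x y : (rhoi y == x) = (y == rho x).
Proof. by rewrite eq_sym eq_rhoi eq_sym. Qed.

Lemma eq_rho x y : (rho x == rho y) = (x == y).
Proof. by apply/eqP/eqP => [/(can_inj rhoK)|->]. Qed.

(** [rho] permutes the four kinds a, b, a^-1, b^-1 in a cycle, so its first three powers fix no
    letter. *)
Lemma rho1 x : (rho x == x) = false.
Proof. by apply/eqP; case: x => [[i []] []]. Qed.

Lemma rho1' x : (x == rho x) = false.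
Proof. by rewrite eq_sym rho1. Qed.

Lemma rho2 x : (rho (rho x) == x) = false.
Proof. by apply/eqP; case: x => [[i []] []]. Qed.

Lemma rho2' x : (x == rho (rho x)) = false.
Proof. by rewrite eq_sym rho2. Qed.

Lemma rho3 x : (rho (rho (rho x)) == x) = false.
Proof. by apply/eqP; case: x => [[i []] []]. Qed.

Lemma rho3' x : (x == rho (rho (rho x))) = false.
Proof. by rewrite eq_sym rho3. Qed.

Lemma iter_nxt4 x : iter 4 nxt x = (ordS x.1.1, x.1.2, x.2).
Proof. by case: x => [[i []] []]. Qed.

Lemma iter_nxt4n n x : 
  exists i : 'I_g, val i = (x.1.1 + n) %% g /\ iter (4 * n) nxt x = (i, x.1.2, x.2).
Proof.
elim: n => [|n [i [vi IH]]].
  exists x.1.1; rewrite addn0 modn_small //; split=> //.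
  by case: x => [[]].
exists (ordS i); split; first by rewrite /= vi -addn1 modnDml -addnA addn1.
by rewrite mulnS iterD IH iter_nxt4.
Qed.

Lemma iter_nxt_period x : iter (4 * g) nxt x = x.
Proof.
have [i [vi ->]] := iter_nxt4n g x.
have -> : i = x.1.1 by apply: val_inj; rewrite vi modnDr modn_small.
by case: x vi => [[]].
Qed.

Lemma iter_nxt_h x : iter h nxt (iter h nxt x) = x.
Proof. by rewrite -iterD -[RHS]iter_nxt_period; congr iter; lia. Qed.

Lemma iter_nxr k x : iter k nxr (linv x) = linv (iter k prv x).
Proof. by elim: k => //= k ->; rewrite /nxr linvK. Qed.

Lemma iter_nxr_rho k x : iter k nxr (rho x) = linv (iter k.+1 prv x).
Proof. by rewrite /rho iter_nxr -iterSr. Qed.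

Lemma iter_prvK k x : iter k nxt (iter k prv x) = x.
Proof. by elim: k x => //= k IH x; rewrite -iterS iterSr /= prvK. Qed.

Lemma iter_nxtK k x : iter k prv (iter k nxt x) = x.
Proof. by elim: k x => //= k IH x; rewrite -iterS iterSr /= nxtK. Qed.

Lemma prv_h x : iter h prv x = iter h nxt x.
Proof. by rewrite -{1}[x]iter_nxt_h iter_nxtK. Qed.

Definition a0 : letter := gen_a (Ordinal (ltnW hg)).

Lemma letter_iter x y : exists2 k, k < 4 * g & iter k nxt x = y.
Proof.
have ex z : exists k, iter k nxt a0 = z.
  have [i [vi e]] := iter_nxt4n z.1.1 a0.
  have {}vi : i = z.1.1 by apply: val_inj; rewrite vi add0n modn_small.
  (* Place in the relator: 0 to 3 within a commutator, plus four per index. *)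
  exists ((z.1.2 + z.2.*2) + 4 * z.1.1).
  by rewrite iterD e vi; case: z {e vi} => [[j []] []].
have per q z : iter (q * (4 * g)) nxt z = z.
  by elim: q => //= q IH; rewrite mulSn iterD IH iter_nxt_period.
have [[m <-] [n <-]] := (ex x, ex y).
(* This is [n - m] modulo [4 * g], with a multiple of the period added to avoid truncated
   subtraction. *)
pose k := n + (m * (4 * g) - m); exists (k %% (4 * g)); first by rewrite ltn_mod; lia.
rewrite -[LHS](per (k %/ (4 * g))) -iterD -divn_eq -iterD /k -addnA subnK ?iterD ?per //.
by rewrite leq_pmulr //; lia.
Qed.

Lemma relatorE : relator g = traject nxt a0 (4 * g).
Proof.
(* With [n = 0] commutators left the index is free, since [ordS] wraps around after the last one. *)
have main n m (i : 'I_g) : m + n = g -> val i = m \/ n = 0 ->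
    flatten [seq commw j | j <- drop m (enum 'I_g)] = traject nxt (gen_a i) (4 * n).
  elim: n m i => [|n IH] m i emn [] // vi.
  - by rewrite drop_oversize // size_enum_ord; lia.
  - by rewrite drop_oversize // size_enum_ord; lia.
  have lm : m < g by lia.
  rewrite (drop_nth i) ?size_enum_ord //.
  have -> : nth i (enum 'I_g) m = i by apply: val_inj; rewrite /= nth_enum_ord.
  rewrite mulnS /= (IH m.+1 (ordS i)) //; first lia.
  case: n {IH} emn => [|n] emn; [by right | left].
  by rewrite /= vi modn_small //; lia.
have := main g 0 (Ordinal (ltnW hg)); rewrite drop0 -/(relator g) => -> //.
by left.
Qed.

Lemma rot_traject (f : letter -> letter) n k c : k <= n -> iter n f c = c ->
  rot k (traject f c n) = traject f (iter k f c) n.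
Proof.
move=> lek per; rewrite /rot -{1 2}(subnKC lek) trajectD.
rewrite drop_size_cat ?take_size_cat ?size_traject //.
rewrite -[X in _ = traject _ _ X](subnK lek) trajectD; congr (_ ++ traject _ _ _).
by rewrite -iterD subnK.
Qed.

Lemma winv_traject c n :
  winv (traject nxt c n) = traject nxr (linv (iter n.-1 nxt c)) n.
Proof.
elim: n => // n IH; rewrite trajectSr /winv map_rcons rev_rcons.
rewrite -/(winv _) IH [RHS]/=; congr (_ :: _).
case: n {IH} => // n; congr (traject nxr _ _).
by rewrite /= /nxr linvK /rho nxtK.
Qed.
End SurfaceGroup.

Section Vertices.
Variable g : nat.
Hypothesis hg : 2 <= g.
Local Notation letter := (letter g).
Local Notation word := (word g).
Local Notation h := (2 * g).
Implicit Types (x y c d : letter) (w u v B : word) (n i j k : nat).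

Local Arguments linv : simpl never.
Local Arguments nxt : simpl never.
Local Arguments prv : simpl never.

(** * The automaton of vertex types *)

(* [None] is the type of the identity.  A vertex of type [Some (d, i, j)] has
   the edge [d] leading one step closer to the identity, and lies at height [i]
   in the polygon to the left of that edge (read towards the vertex) and at
   height [j] in the polygon to its right.  When [j = h] it is the top of the
   latter polygon and [rho d] leads closer to the identity as well. *)
Definition state := option (letter * nat * nat).
Implicit Type s : state.

(** At a top the left descending edge is recorded, so that polygon lies to its right and [i] stays
    below [h]. Climbing one polygon leaves the other behind, so at most one height exceeds 1. *)
Definition valid s :=
  if s is Some (d, i, j)
  then [&& 0 < i, i < h, 0 < j, j <= h & (i == 1) || (j == 1)] else true.

Definition desc s y :=
  if s is Some (d, i, j) then (y == d) || (j == h) && (y == rho d) else false.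

(** [rhoi d] continues the left polygon, [rho] of the rightmost descending edge the right one; other
    letters enter new polygons on both sides. At [j = h] the rightmost edge is [rho d], with height
    1 in the polygon beyond it. *)
Definition delta s y : state :=
  if s is Some (d, i, j) then
    if y == rhoi d then
      if i.+1 == h then Some (rhoi (linv y), 1, h) else Some (linv y, i.+1, 1)
    else if y == rho (if j == h then rho d else d) then
      Some (linv y, 1, (if j == h then 1 else j).+1)
    else Some (linv y, 1, 1)
  else Some (linv y, 1, 1).

(* [lbot s y]: the polygon to the left of the edge [y] leaving [s] has [s] as its
   lowest vertex.  [rbot s y]: [s] is entered along [y], and the polygon to the
   right of [y] has the origin of [y] as its lowest vertex. *)
Definition lbot s y := ~~ desc s y && ~~ desc s (rho y).
Definition rbot s y :=
  if s is Some (d, i, j)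
  then (j == 1) && (d == linv y) || (j == h) && (rho d == linv y) else false.

(* A top is entered by two edges; the normal form uses the left one only. *)
Definition topstep s y :=
  if s is Some (d, i, j) then (y == rhoi d) && (i.+1 == h) else false.
Definition tree s y := ~~ desc s y && ~~ topstep s y.

(* Words are stored with their last letter first. *)
Definition vtype w : state := foldr (fun y s => delta s y) None w.
Fixpoint normal w := if w is y :: w' then normal w' && tree (vtype w') y else true.

Let rhos := (eq_rhoi, rhoi_eq, eq_rho, rho1, rho1', rho2, rho2', rho3, rho3', rhoiK).

Lemma delta_valid s y : valid s -> ~~ desc s y -> valid (delta s y).
Proof.
case: s => [[[d i] j]|] /=; last by move=> _ _; lia.
case: ifP => _; first by case: ifP => /= ? ?; lia.
by move=> V _; case: (eqVneq j h) => /= jh; case: (y == rho _) => /=; lia.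
Qed.

Lemma desc_delta s y : desc (delta s y) (linv y).
Proof.
case: s => [[[d i] j]|] /=; last by rewrite eqxx.
case: ifP => _; first by case: ifP => _ /=; rewrite ?(rhoiK (linv y)) !eqxx ?orbT.
by case: (y == rho _) => /=; rewrite eqxx.
Qed.

(** At the origin of [y] the polygon to the right has sides [y] and [rhoi y]; the origin is its
    bottom when both lead away. *)
Lemma rbot_delta s y : valid s -> ~~ desc s y ->
  rbot (delta s y) y = ~~ desc s (rhoi y).
Proof.
case: s => [[[d i] j]|] /=; last by rewrite !eqxx.
rewrite 2!rhoi_eq => V /norP[yd].
have h1 : (1 == h) = false by lia.
have h1' : (h == 1) = false by lia.
have [->|Nyd] := eqVneq y (rhoi d).
  move=> _; rewrite !rhos andbF orbF.
  by case: ifP => _ /=; rewrite ?h1' ?(rhoiK (linv _)) !eqxx /= ?orbT.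
have [jh|Njh] := eqVneq j h.
  rewrite /= => Nyd2; have [->|Nyd3] := eqVneq y (rho (rho d)).
    rewrite /= !rhos /= ?eqxx.
    by have -> : (2 == h) = false by lia.
  by rewrite /= eqxx (negbTE Nyd2).
move=> _; have [->|Nyd3] := eqVneq y (rho d).
  rewrite /= !rhos eqxx /= andbF.
  have -> : (j.+1 == 1) = false by lia.
  done.
by rewrite /= ?eqxx h1.
Qed.

(** * Normal forms along the two sides of a polygon *)

Lemma lbot_neq s y d i j : s = Some (d, i, j) -> lbot s y -> y != rhoi d.
Proof. by move=> ->; rewrite /lbot /= !rhos => /andP[_ /norP[]]. Qed.

Lemma valid_vtype w : normal w -> valid (vtype w).
Proof.
elim: w => // y w IH /= /andP[/IH V /andP[D _]].
exact: delta_valid.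
Qed.

(** Only step [h] would be a top step, so the climb stays normal. The first letter may continue
    another polygon on its right, hence [j] is known only for [1 < n]. *)
Lemma left_chain B c n : normal B -> lbot (vtype B) c -> 0 < n < h ->
  normal (rev (traject (@nxt g) c n) ++ B) /\
  exists j, vtype (rev (traject (@nxt g) c n) ++ B) = Some (linv (iter n.-1 (@nxt g) c), n, j)
    /\ (1 < n -> j = 1).
Proof.
move=> nB L; elim: n => // -[|n] IH lnh.
  have D : ~~ desc (vtype B) c by case/andP: L.
  have := valid_vtype nB; have := lbot_neq _ L; rewrite /= nB /tree D /=.
  case: (vtype B) => [[[d i] j]|] /=; last by move=> *; split=> //; exists 1.
  move=> /(_ _ _ _ erefl) /negbTE -> _; split=> //.
  by case: ifP => _; eexists; split.
have [|nw [j [sw jE]]] := IH; first lia.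
rewrite trajectSr rev_rcons cat_cons /= nw /tree sw /=.
set x := iter n (@nxt g) c.
have -> : nxt x = rhoi (linv x) by rewrite nxtE.
rewrite !rhos eqxx andbF /=.
have -> : (n.+2 == h) = false by lia.
by split=> //; exists 1.
Qed.

(** The first side [y] is already part of [u], which need not be of the form [y :: B]: that step may
    itself enter a top from the right. *)
Lemma right_chain u y n : normal u -> rbot (vtype u) y -> 0 < n < h ->
  normal (rev (traject (@nxr g) (nxr y) n) ++ u) /\
  vtype (rev (traject (@nxr g) (nxr y) n) ++ u) = Some (linv (iter n (@nxr g) y), 1, n.+1).
Proof.
move=> nu R; elim: n => // -[|n] IH lnh.
  have := valid_vtype nu; move: R; rewrite /= nu /tree /nxr.
  case: (vtype u) => [[[d i] j]|] //=.
  have [-> /=|N1 /=] := eqVneq j 1.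
    have -> : (1 == h) = false by lia.
    by rewrite orbF => /eqP ->; rewrite !rhos eqxx.
  move=> /andP[/eqP-> /eqP<-] V; rewrite !rhos !eqxx /=; split=> //.
have [|nw sw] := IH; first lia.
rewrite trajectSr rev_rcons cat_cons -iterSr /= nw /tree sw /=.
set x := nxr (iter n (@nxr g) y).
have -> : (n.+2 == h) = false by lia.
by rewrite /nxr !rhos eqxx.
Qed.

Lemma delta_tree s y : tree s y -> exists i j, delta s y = Some (linv y, i, j).
Proof.
case: s => [[[d i] j]|] /andP[_ /=]; last by exists 1, 1.
case: ifP => [_ /= /negbTE ->|_ _]; first by exists i.+1, 1.
by case: (y == rho _); [exists 1, (if j == h then 1 else j).+1 | exists 1, 1].
Qed.

Lemma left_struct w d i j : normal w -> vtype w = Some (d, i, j) -> exists B c,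
  [/\ w = rev (traject (@nxt g) c i) ++ B, normal B, lbot (vtype B) c
    & d = linv (iter i.-1 (@nxt g) c)].
Proof.
elim: w d i j => // y w IH d i j /= /andP[nw].
rewrite /tree => /andP[D].
case sw: (vtype w) D => [[[d0 i0] j0]|] /= D; last first.
  by move=> _ [<- <- _]; exists w, y; rewrite sw.
have [yd0|yd0] := eqVneq y (rhoi d0).
  move=> /= /negbTE -> [<- <- _].
  have [B [c [wE nB L dE]]] := IH _ _ _ nw sw.
  have := valid_vtype nw; rewrite sw /= => V.
  have i0E : i0 = i0.-1.+1 by lia.
  have yE : y = iter i0 (@nxt g) c by rewrite yd0 dE i0E /= -nxtE.
  by exists B, c; split=> //=; rewrite ?yE // -trajectS trajectSr rev_rcons cat_cons wE.
(* [rho y] is not [d0], as [y] is not [rhoi d0], and not [rho d0], as [y] does not descend. *)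
have L : lbot (vtype w) y.
  by rewrite /lbot sw /= D !rhos negb_or -eq_rhoi yd0 /=; case/norP: D => /negbTE ->; rewrite andbF.
move=> _; case: (y == rho _) => -[<- <- _]; by exists w, y.
Qed.

Lemma right_struct w d i j : normal w -> vtype w = Some (d, i, j) -> 1 < j -> exists u y,
  [/\ w = rev (traject (@nxr g) (nxr y) j.-1) ++ u, normal u, rbot (vtype u) y
    & d = linv (iter j.-1 (@nxr g) y)].
Proof.
elim: w d i j => // y w IH d i j /= /andP[nw].
rewrite /tree => /andP[D].
case sw: (vtype w) D => [[[d0 i0] j0]|] /= D; last by move=> _ [_ _ <-].
case: (y == rhoi d0); first by move=> /= /negbTE -> [_ _ <-].
have [j0h|j0h] := eqVneq j0 h.
  have [yE _|_ _ [_ _ <-//]] := eqVneq y (rho (rho d0)).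
  (* From a top the new polygon lies to the right of the second descending edge, which is thus its
     first side. *)
  move=> -[<- _ <-] _; exists w, (linv (rho d0)).
  by rewrite /= /nxr !linvK sw /= j0h !eqxx orbT -yE; split; rewrite // yE [LHS]linvK.
have [yE _|_ _ [_ _ <-//]] := eqVneq y (rho d0).
move=> -[<- _ <-] _.
have := valid_vtype nw; rewrite sw /= => V.
have [j1|j1] := eqVneq j0 1.
  exists w, (linv d0); rewrite j1 sw /= j1 /nxr !linvK -yE !eqxx.
  by split; rewrite // yE [LHS]linvK.
have [|u [x [wE nu R dE]]] := IH _ _ _ nw sw; first lia.
have j0E : j0 = j0.-1.+1 by lia.
have yE' : y = iter j0 (@nxr g) x by rewrite yE dE [in RHS]j0E.
exists u, x; split=> //=; last by rewrite yE'.
by rewrite {1}j0E trajectSr rev_rcons cat_cons wE -iterSr -j0E yE'.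
Qed.

(* The edges of the Cayley graph that lead away from the identity, between
   vertices given by their normal forms.  In [up_top], [B] is the lowest vertex
   of the polygon whose top is reached from the right. *)
Inductive up : word -> letter -> word -> Prop :=
| up_tree w y : normal w -> tree (vtype w) y -> up w y (y :: w)
| up_top B c u w y w' : normal B -> lbot (vtype B) c -> up B (rho c) u ->
    w = rev (traject (@nxt g) c h.-1) ++ B -> y = iter h.-1 (@nxt g) c ->
    w' = rev (traject (@nxr g) (nxr (rho c)) h.-1) ++ u -> up w y w'.

(** * Edges between normal forms: existence and uniqueness *)

Lemma nxr_half c : iter h.-1 (@nxr g) (rho c) = linv (iter h (@nxt g) c).
Proof.
have hE : h = h.-1.+1 by lia.
by rewrite iter_nxr_rho -hE prv_h.
Qed.

(** Induction on the edge at the bottom: the type [delta] assigns to a top entered from the right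
    agrees with the one found by climbing the left side. *)
Lemma up_inv w y w' : up w y w' ->
  [/\ normal w, normal w', ~~ desc (vtype w) y, vtype w' = delta (vtype w) y & size w' = (size w).+1].
Proof.
elim=> {w y w'} [w y nw T|B c u w y w' nB L _ [_ nu D su zu] -> -> ->].
  by split=> //=; rewrite ?nw //; case/andP: T.
have [|nw [j [sw jE]]] := left_chain (n := h.-1) nB L; first by lia.
have [||nw' sw'] := right_chain (y := rho c) (n := h.-1) nu.
- by rewrite su rbot_delta ?valid_vtype // rhoK; case/andP: L.
- by lia.
have yE : iter h.-1 (@nxt g) c = rhoi (linv (iter h.-1.-1 (@nxt g) c)).
  by rewrite -nxtE -iterS; congr (iter _ (@nxt g) _); lia.
split=> //.
- by rewrite sw /= yE !rhos andbF.
- have E1 : h.-1.+1 = h by lia.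
  rewrite sw sw' nxr_half linvK /= -yE eqxx E1 eqxx -nxtE -iterS E1; done.
- by rewrite !size_cat !size_rev !size_traject zu addnS.
Qed.

(** For a top step, descend to the bottom of the polygon, apply induction to its other first side,
    and climb from there. *)
Lemma up_exists w y : normal w -> ~~ desc (vtype w) y -> exists w', up w y w'.
Proof.
have [n] := ubnP (size w); elim: n w y => // n IH w y szw nw D.
case T: (topstep (vtype w) y); last first.
  by exists (y :: w); apply: up_tree; rewrite // /tree D T.
case sw: (vtype w) T => [[[d i] j]|] //= /andP[/eqP yE /eqP iE].
have [B [c [wE nB L dE]]] := left_struct nw sw.
have {}iE : i = h.-1 by lia.
case: (IH B (rho c)) => [|||u upu] //.
- by move: szw; rewrite wE size_cat size_rev size_traject; lia.
- by case/andP: L.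
exists (rev (traject (@nxr g) (nxr (rho c)) h.-1) ++ u).
apply: (up_top nB L upu) => //; first by rewrite -iE.
by rewrite yE dE -nxtE -iterS; congr (iter _ (@nxt g) _); lia.
Qed.

(** The second descending edge of a top is found by going down the left side to the bottom, the last
    edge by induction, and climbing the right side. *)
Lemma down_exists w y : normal w -> desc (vtype w) y -> exists w', up w' (linv y) w.
Proof.
have [n] := ubnP (size w); elim: n w y => // n IH w y szw nw.
case sw: (vtype w) => [[[d i] j]|] //= /orP[/eqP ->|/andP[/eqP jh /eqP yE]].
  case: w nw sw szw => // z w /= /andP[nw T] sw _.
  have [i' [j']] := delta_tree T; rewrite sw => -[-> _ _].
  by exists w; rewrite linvK; apply: up_tree.
have [|u [x [wE nu R dE]]] := right_struct nw sw; first lia.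
case: (IH u (linv x)) => [|||B] //.
- by move: szw; rewrite wE size_cat size_rev size_traject; lia.
- case: (vtype u) R => [[[d0 i0] j0]|] //= /orP[/andP[_ /eqP->]|/andP[/eqP-> /eqP->]];
  by rewrite !eqxx ?orbT.
rewrite linvK => upx; have [nB _ D su _] := up_inv upx.
exists (rev (traject (@nxt g) (rhoi x) h.-1) ++ B).
apply: (@up_top B (rhoi x) u) => //; rewrite ?rhoiK //.
- by rewrite /lbot rhoiK D andbT -rbot_delta // -?su // valid_vtype.
- rewrite yE dE jh -[x]rhoiK nxr_half linvK rhoiK.
  have {1}-> : h = h.-1.+1 by lia.
  by rewrite iterS /rho nxtK linvK.
- by rewrite wE jh.
Qed.

Lemma cat_inj_size (T : Type) (s1 s2 t1 t2 : seq T) :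
  size s1 = size s2 -> s1 ++ t1 = s2 ++ t2 -> t1 = t2.
Proof. by move=> E /(congr1 (drop (size s1))); rewrite drop_size_cat // E drop_size_cat. Qed.

(** Tells the two constructors of [up] apart by their origin; [up_top_last] does so by their end. *)
Lemma up_top_not_tree B c : normal B -> lbot (vtype B) c ->
  topstep (vtype (rev (traject (@nxt g) c h.-1) ++ B)) (iter h.-1 (@nxt g) c).
Proof.
move=> nB L.
have [|nw [j [-> jE]]] := left_chain (n := h.-1) nB L; first by lia.
apply/andP; split; last by apply/eqP; lia.
by rewrite -nxtE -iterS; apply/eqP; congr (iter _ (@nxt g) _); lia.
Qed.

Lemma up_fun w y w1 w2 : up w y w1 -> up w y w2 -> w1 = w2.
Proof.
move=> U; elim: U w2 => {w y w1} [w y nw T|B c u w y w' nB L _ IH wE yE w'E] w2 U.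
  case: U nw T => // B c u {}w {}y w' nB L _ -> -> _ _.
  by rewrite /tree up_top_not_tree // andbF.
case: U wE yE => [{}w {}y nw T wE yE|B2 c2 u2 {}w {}y w'2 nB2 L2 up2 wE2 yE2 w'E2 wE yE].
  by move: T; rewrite /tree wE yE up_top_not_tree // andbF.
have cE : c = c2.
  by move: yE; rewrite yE2 => /(congr1 (iter h.-1 (@prv g))); rewrite !iter_nxtK.
subst c2.
have BE : B2 = B by apply: cat_inj_size (etrans (esym wE2) wE).
by subst B2; rewrite w'E w'E2 (IH _ up2).
Qed.

Lemma up_top_last c u z w :
  z :: w = rev (traject (@nxr g) (nxr (rho c)) h.-1) ++ u -> z != iter h.-1 (@nxt g) c.
Proof.
have E1 : h.-1 = h.-2.+1 by lia.
rewrite [in rev _]E1 trajectSr rev_rcons cat_cons -iterSr -E1 nxr_half => -[-> _].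
have -> : iter h (@nxt g) c = nxt (iter h.-1 (@nxt g) c).
  by rewrite -iterS; congr (iter _ (@nxt g) _); lia.
rewrite nxtE; apply/eqP => /(congr1 (@linv g)).
by rewrite [LHS]linvK => /eqP; rewrite rhoi_eq rho1'.
Qed.

Lemma up_cofun w1 w2 y w : up w1 y w -> up w2 y w -> w1 = w2.
Proof.
have tree_cofun v x w' : up v x (x :: w') -> v = w'.
  move tE: (x :: w') => t U.
  case: U tE => [? ? _ _ [_]//|B c u v0 x0 t' _ _ _ _ -> -> tE].
  by have := up_top_last tE; rewrite eqxx.
move=> U; elim: U w2 => {w1 y w} [w y nw T|B c u w y w' nB L _ IH wE yE w'E] w2 U.
  by rewrite (tree_cofun _ _ _ U).
case: U yE w'E => [v x _ _ yE w'E|B2 c2 u2 v x t' _ _ up2 vE xE -> yE tE].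
  by have := up_top_last w'E; rewrite yE eqxx.
have cE : c = c2.
  by move: yE; rewrite xE => /(congr1 (iter h.-1 (@prv g))); rewrite !iter_nxtK.
subst c2.
have uE : u2 = u by apply: cat_inj_size tE.
by subst u2; rewrite wE vE (IH _ up2).
Qed.
End Vertices.

Section Action.
Variable g : nat.
Hypothesis hg : 2 <= g.
Local Notation letter := (letter g).
Local Notation word := (word g).
Local Notation h := (2 * g).
Local Notation nxt := (@nxt g).
Local Notation nxr := (@nxr g).
Implicit Types (x y c d : letter) (w u v B z : word) (n i j k : nat).

(** * The action of words on vertices *)

Definition nbr w y w' := up w y w' \/ up w' (linv y) w.

Lemma nbr_normal w y w' : nbr w y w' -> normal w /\ normal w'.
Proof. by case=> /(up_inv hg)[]. Qed.

Lemma nbr_sym w y w' : nbr w y w' -> nbr w' (linv y) w.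
Proof. by case=> U; [right; rewrite linvK | left]. Qed.

Lemma nbr_exists w y : normal w -> exists w', nbr w y w'.
Proof.
move=> nw; case D: (desc (vtype w) y).
  by have [w' U] := down_exists hg nw D; exists w'; right.
by have [w' U] := up_exists hg nw (negbT D); exists w'; left.
Qed.

Lemma nbr_fun w y w1 w2 : nbr w y w1 -> nbr w y w2 -> w1 = w2.
Proof.
(* Contradictory hypotheses: the way back along an upward edge is a descending letter. *)
have excl v1 v2 : up w y v1 -> up v2 (linv y) w -> v1 = v2.
  case/(up_inv hg) => _ _ /negP D _ _ /(up_inv hg)[_ _ _ sw _]; case: D.
  by rewrite sw -[y in desc _ y]linvK desc_delta.
case=> U1 [] U2; first exact: up_fun hg _ _ _ _ U1 U2.
- exact: excl.
- by apply/esym/excl.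
- exact: up_cofun hg _ _ _ _ U1 U2.
Qed.

Fixpoint walk w z w' : Prop :=
  if z is y :: z' then exists2 w1, nbr w y w1 & walk w1 z' w' else normal w /\ w' = w.

Lemma walk_normal w z w' : walk w z w' -> normal w /\ normal w'.
Proof.
elim: z w => /= [|y z IH] w; first by move=> [nw ->].
by move=> [w1 /nbr_normal[nw _] /IH[]].
Qed.

Lemma walk1 w y w' : nbr w y w' -> walk w [:: y] w'.
Proof. by move=> N; exists w' => //; split=> //; case/nbr_normal: N. Qed.

Lemma walk_cat w z1 z2 w' :
  walk w (z1 ++ z2) w' <-> exists2 v, walk w z1 v & walk v z2 w'.
Proof.
elim: z1 w => /= [|y z1 IH] w.
  split=> [W|[v [nw ->]] //]; exists w => //.
  by case/walk_normal: W.
split=> [[w1 N /IH[v W1 W2]]|[v [w1 N W1] W2]].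
  by exists v => //; exists w1.
by exists w1 => //; apply/IH; exists v.
Qed.

Lemma walk_fun w z w1 w2 : walk w z w1 -> walk w z w2 -> w1 = w2.
Proof.
elim: z w => /= [|y z IH] w; first by move=> [_ ->] [_ ->].
by move=> [v1 N1 W1] [v2 N2 W2]; apply: IH W1 _; rewrite (nbr_fun N1 N2).
Qed.

Lemma walk_exists w z : normal w -> exists w', walk w z w'.
Proof.
elim: z w => /= [|y z IH] w nw; first by exists w.
have [w1 N] := nbr_exists y nw; have [_ /IH[w' W]] := nbr_normal N.
by exists w', w1.
Qed.

Lemma walk_winv w z w' : walk w z w' -> walk w' (winv z) w.
Proof.
elim: z w => /= [|y z IH] w; first by move=> [nw ->].
move=> [w1 N /IH W]; rewrite /winv /= rev_cons -cats1.
by apply/walk_cat; exists w1 => //; apply/walk1/nbr_sym.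
Qed.

Lemma walk_tree w z : normal (rev z ++ w) -> walk w z (rev z ++ w).
Proof.
elim: z w => //= y z IH w; rewrite rev_cons cat_rcons => nzw.
exists (y :: w); last exact: IH.
have : normal (y :: w) by elim: (rev z) nzw => //= ? s IHs /andP[/IHs].
by move=> /= /andP[nw T]; left; apply: up_tree.
Qed.

(** * Polygons close up *)

Definition loop w y := walk w (traject nxt y (4 * g)) w.

Lemma loop_nbr w y w1 : nbr w y w1 -> (loop w y <-> loop w1 (nxt y)).
Proof.
move=> N; rewrite /loop.
have E : 4 * g = (4 * g).-1.+1 by lia.
have -> : traject nxt (nxt y) (4 * g) = traject nxt (nxt y) (4 * g).-1 ++ [:: y].
  by rewrite {1}E trajectSr -iterSr -E iter_nxt_period cats1.
rewrite E /=; split=> [[v N' W]|/walk_cat[v W [v' N' [_ v'E]]]].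
  by apply/walk_cat; exists w; rewrite (nbr_fun N N') //; exact: walk1.
exists w1 => //; suff -> : w = v by [].
by subst v'; exact: nbr_fun (nbr_sym N) (nbr_sym N').
Qed.

Lemma winvK : involutive (@winv g).
Proof.
move=> z; rewrite /winv map_rev revK -map_comp.
by rewrite (eq_map (@linvK g)) map_id.
Qed.

(** The second half of a polygon, read backwards, is the path up its other side. *)
Lemma winv_half c : winv (traject nxt (iter h nxt c) h) = traject nxr (rho c) h.
Proof.
rewrite winv_traject -iterD /rho; congr (traject _ (linv _) _).
rewrite -[prv c]iter_nxt_period -[4 * g]prednK; last lia.
by rewrite iterSr prvK; congr (iter _ nxt _); lia.
Qed.

(** By [up_top] both sides climbed from the bottom meet in one top. *)
Lemma loop_lbot B c : normal B -> lbot (vtype B) c -> loop B c.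
Proof.
move=> nB L; have [||u upu] := @up_exists g hg B (rho c) => //; first by case/andP: L.
have U := up_top nB L upu erefl erefl erefl.
have [nw nw' _ _ _] := up_inv hg U.
have E : h = h.-1.+1 by lia.
rewrite /loop (_ : 4 * g = h + h); last lia.
rewrite trajectD; apply/walk_cat.
eexists; last first.
  rewrite -[traject _ _ _]winvK winv_half; apply: walk_winv.
  rewrite {1}E /=; exists u; [by left | exact: walk_tree nw'].
rewrite {1}E trajectSr -cats1; apply/walk_cat.
by eexists; [exact: walk_tree nw | apply: walk1; left].
Qed.

(** Unless [w] is the bottom, [y] or [rho y] descends, and the loop is rotated along it to a shorter
    normal form. *)
Lemma loop_all w y : normal w -> loop w y.
Proof.
have [n] := ubnP (size w); elim: n w y => // n IH w y szw nw.
have [L|] := boolP (lbot (vtype w) y); first exact: loop_lbot.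
rewrite negb_and !negbK => /orP[] D; have [w' U] := down_exists hg nw D.
  have [nw' _ _ _ zw] := up_inv hg U.
  by apply/(loop_nbr (w1 := w')); [right | apply: IH => //; move: szw; rewrite zw].
have [nw' _ _ _ zw] := up_inv hg U.
rewrite /rho linvK in U.
rewrite -[y]prvK; apply/(loop_nbr (w := w')); first by left.
by apply: IH => //; move: szw; rewrite zw.
Qed.

Lemma walk_step w z1 z2 w' : step z1 z2 -> walk w z1 w' <-> walk w z2 w'.
Proof.
(* A word fixing every vertex can be inserted anywhere. *)
suff ins u s v : (forall w0, normal w0 -> walk w0 s w0) ->
    walk w (u ++ v) w' <-> walk w (u ++ s ++ v) w'.
  case=> [u v x|u v]; apply: ins => w0 nw0.
    have [w1 N] := nbr_exists x nw0.
    by exists w1 => //; apply/walk1/nbr_sym.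
  by rewrite (relatorE hg); exact: loop_all.
move=> ids; split=> /walk_cat[w1 W1].
  have [_ nw1] := walk_normal W1.
  move=> W2; apply/walk_cat; exists w1 => //; apply/walk_cat; exists w1 => //.
  exact: ids.
move=> /walk_cat[w2 Ws W2]; apply/walk_cat; exists w1 => //.
by have [/ids/walk_fun/(_ Ws) -> _] := walk_normal Ws.
Qed.

Lemma walk_eqw w z1 z2 w' : eqw z1 z2 -> walk w z1 w' <-> walk w z2 w'.
Proof.
elim=> {z1 z2} [z1 z2 S|z|z1 z2 _ IH|z1 z2 z3 _ IH1 _ IH2].
- exact: walk_step.
- by [].
- exact: iff_sym.
- exact: iff_trans IH1 IH2.
Qed.

(** * Soundness of the action in the group *)

Lemma eqw_refl z : eqw z z. Proof. exact: rst_refl. Qed.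
Lemma eqw_sym z1 z2 : eqw z1 z2 -> eqw z2 z1. Proof. exact: rst_sym. Qed.
Lemma eqw_trans z2 z1 z3 : eqw z1 z2 -> eqw z2 z3 -> eqw z1 z3.
Proof. exact: rst_trans. Qed.

Lemma eqw_ctx u v z1 z2 : eqw z1 z2 -> eqw (u ++ z1 ++ v) (u ++ z2 ++ v).
Proof.
elim=> {z1 z2} [z1 z2 S|z|z1 z2 _ IH|z1 z2 z3 _ IH1 _ IH2].
- apply: rst_step; case: S => [p q x|p q];
  have ctx s : u ++ (p ++ s) ++ v = (u ++ p) ++ (s ++ v) by rewrite !catA.
    by rewrite !ctx -(catA [:: x; linv x]); exact: step_free.
  by rewrite !ctx -(catA (relator g)); exact: step_rel.
- exact: eqw_refl.
- exact: eqw_sym.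
- exact: eqw_trans IH1 IH2.
Qed.

Lemma eqw_catl u z1 z2 : eqw z1 z2 -> eqw (u ++ z1) (u ++ z2).
Proof. by move=> /(eqw_ctx u [::]); rewrite !cats0. Qed.

Lemma eqw_catr v z1 z2 : eqw z1 z2 -> eqw (z1 ++ v) (z2 ++ v).
Proof. exact: (eqw_ctx [::]). Qed.

Lemma eqw_free x : eqw [:: x; linv x] [::].
Proof. by apply/eqw_sym/rst_step; exact: (@step_free g [::] [::]). Qed.

Lemma eqw_free' x : eqw [:: linv x; x] [::].
Proof. by rewrite -{2}[x]linvK; exact: eqw_free. Qed.

Lemma eqw_winv z : eqw (z ++ winv z) [::].
Proof.
elim: z => [|x z IH]; first exact: eqw_refl.
rewrite /winv /= rev_cons -cats1 catA.
exact: eqw_trans (eqw_ctx [:: x] [:: linv x] IH) (eqw_free x).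
Qed.

(** Each rotation of the relator is a conjugate of the previous one by a letter. *)
Lemma eqw_loop c : eqw (traject nxt c (4 * g)) [::].
Proof.
have [k _ <-] := letter_iter hg (a0 hg) c; elim: k => [|k IH].
  rewrite -(relatorE hg); apply/eqw_sym/rst_step.
  by rewrite -[relator g]cats0; exact: (@step_rel g [::] [::]).
have E : 4 * g = (4 * g).-1.+1 by lia.
rewrite iterS; set x := iter k nxt _ in IH *.
rewrite E trajectSr -iterSr -E iter_nxt_period -cats1.
move: IH; rewrite {1}E /=; set t := traject _ _ _ => IH.
apply: eqw_trans (eqw_free' x).
apply: eqw_trans (eqw_ctx [:: linv x] [:: x] IH).
exact/eqw_sym/(eqw_ctx [::] (t ++ [:: x]) (eqw_free' x)).
Qed.

Lemma eqw_half c : eqw (traject nxt c h) (traject nxr (rho c) h).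
Proof.
rewrite -winv_half; set Q := traject _ (iter _ _ _) _.
have /(eqw_catr (winv Q)) := eqw_loop c.
rewrite (_ : 4 * g = h + h); last lia.
rewrite (trajectD _ h h) -/Q.
rewrite -catA => /(eqw_trans _); apply.
by have := eqw_catl (traject nxt c h) (eqw_sym (eqw_winv Q)); rewrite cats0.
Qed.

Lemma up_eqw w y w' : up w y w' -> eqw (rev w ++ [:: y]) (rev w').
Proof.
elim=> {w y w'} [w y _ _|B c u w y w' _ _ _ IH -> -> ->].
  by rewrite rev_cons cats1; exact: eqw_refl.
have E : h = h.-1.+1 by lia.
rewrite !rev_cat !revK -catA cats1 -trajectSr -E.
apply: eqw_trans (eqw_catl _ (eqw_half c)) _.
by rewrite E /= -cat_rcons -cats1; exact: eqw_catr.
Qed.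

Lemma nbr_eqw w y w' : nbr w y w' -> eqw (rev w ++ [:: y]) (rev w').
Proof.
case=> /up_eqw //; move/(eqw_catr [:: y])/eqw_sym/eqw_trans; apply.
by rewrite -catA; have := eqw_catl (rev w') (eqw_free' y); rewrite cats0.
Qed.

Lemma walk_sound w z w' : walk w z w' -> eqw (rev w ++ z) (rev w').
Proof.
elim: z w => [|y z IH] w /=; first by move=> [_ ->]; rewrite cats0; exact: eqw_refl.
move=> [w1 /nbr_eqw/(eqw_catr z) E /IH]; apply: eqw_trans.
by rewrite -catA in E.
Qed.
End Action.

Section Cones.
Variable g : nat.
Hypothesis hg : 2 <= g.
Local Notation letter := (letter g).
Local Notation word := (word g).
Local Notation h := (2 * g).
Local Notation nxt := (@nxt g).
Local Notation nxr := (@nxr g).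
Implicit Types (y c d : letter) (w u v x z t : word) (n i j k : nat) (s : state g).

(** * Word length and cone types *)

Fixpoint runs s z :=
  if z is y :: z' then ~~ desc s y && runs (delta s y) z' else true.

(** Each edge changes the length of the normal form by one, so the maximum is attained exactly when
    no letter descends. *)
Lemma walk_runs w z w' : walk w z w' ->
  size w' <= size w + size z /\ (size w' == size w + size z) = runs (vtype w) z.
Proof.
elim: z w => [|y z IH] w /=; first by move=> [_ ->]; rewrite addn0 leqnn eqxx.
move=> [w1 N /IH[le1 r1]]; case: N => /(up_inv hg)[_ _ D s1 z1].
  by rewrite D -s1 -r1 -addSnnS -z1.
have -> /= : desc (vtype w) y by rewrite s1 -[y in desc _ y]linvK desc_delta.
move: le1; rewrite z1; move: (size w') (size w1) (size z) => a b e leab.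
by split; first lia; apply/eqP; lia.
Qed.

(** Equivalent words lead to the same vertex [t], so none is shorter than [t], and [rev t] attains
    this bound. *)
Lemma wlenE z t : walk [::] z t -> wlen z = size t.
Proof.
move=> W; have len : is_len z (size t).
  split=> [|z' /(walk_eqw hg [::] t) [_ /(_ W)/walk_runs[]] //].
  exists (rev t); rewrite size_rev; split=> //.
  exact/eqw_sym/(walk_sound hg W).
(* The [epsilon] choice is pinned down because a least length is unique. *)
rewrite /wlen; have := epsilon_spec (inhabits 0) (fun n => is_len z n) (ex_intro _ _ len).
move: (epsilon _ _) => m [[z1 [e1 <-]] min1]; case: len => [[z2 [e2 <-]] min2].
by apply/eqP; rewrite eqn_leq min1 // min2.
Qed.

(** [rev t] is a shortest word for [z]; lengths add up exactly when it only climbs from [v]. *)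
Lemma in_coneP x z v t : walk [::] x v -> walk [::] z t ->
  in_cone x z <-> runs (vtype v) (rev t).
Proof.
move=> Wx Wz; have [_ nv] := walk_normal hg Wx.
have [w' W] := walk_exists hg (rev t) nv.
have W' : walk [::] (x ++ z) w'.
  by apply/(walk_cat hg); exists v => //; apply/(walk_eqw hg v w' (walk_sound hg Wz)).
rewrite /in_cone (wlenE Wx) (wlenE Wz) (wlenE W') -(size_rev t).
have [_ <-] := walk_runs W; by split=> /eqP.
Qed.

Lemma same_cone_vtype x1 x2 v1 v2 : walk [::] x1 v1 -> walk [::] x2 v2 ->
  vtype v1 = vtype v2 -> same_cone x1 x2.
Proof.
move=> W1 W2 e z; have [t Wz] := walk_exists hg z (isT : normal ([::] : word)).
by rewrite (in_coneP W1 Wz) (in_coneP W2 Wz) e.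
Qed.

Lemma same_cone_eqw x1 x2 : eqw x1 x2 -> same_cone x1 x2.
Proof.
move=> e; have [v W] := walk_exists hg x1 (isT : normal ([::] : word)).
by apply: (same_cone_vtype W _ erefl); apply/(walk_eqw hg _ _ (eqw_sym e)).
Qed.

(** A word accepted from the identity is itself shortest, so it tests cones directly. *)
Lemma in_cone_runs x v z : walk [::] x v -> runs None z ->
  in_cone x z <-> runs (vtype v) z.
Proof.
move=> Wx r; have [_ nv] := walk_normal hg Wx.
have [t Wz] := walk_exists hg z (isT : normal ([::] : word)).
have [w' W] := walk_exists hg z nv.
have W' : walk [::] (x ++ z) w' by apply/(walk_cat hg); exists v.
rewrite /in_cone (wlenE Wx) (wlenE Wz) (wlenE W').
have [_] := walk_runs Wz; rewrite r add0n => /eqP ->.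
have [_ <-] := walk_runs W; by split=> /eqP.
Qed.

(** [h - i] sides remain up to the top; the next one descends. *)
Lemma runs_left d i j k : 0 < i < h ->
  runs (Some (d, i, j)) (traject nxt (rhoi d) k) = (k <= h - i).
Proof.
elim: k d i j => [|k IH] d i j ih //=.
rewrite eqxx [rhoi d == d]rhoi_eq [rhoi d == rho d]rhoi_eq rho1' rho2' andbF /=.
case: ifP => [/eqP iE|/eqP iE]; last by rewrite nxtE IH; lia.
have -> : h - i = 1 by lia.
by case: k {IH} => //= k; rewrite nxtE eqxx.
Qed.

Lemma runs_right d i j k : 0 < j <= h ->
  runs (Some (d, i, j)) (traject nxr (rho d) k) = (k <= h - j).
Proof.
elim: k d i j => [|k IH] d i j jh //=.
rewrite rho1 eqxx andbT eq_rhoi rho2 /=.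
have [->|jE] /= := eqVneq j h; first by rewrite subnn.
by rewrite eqxx /nxr IH; lia.
Qed.

Lemma runs_left0 c k : k <= h -> runs None (traject nxt c k).
Proof. by case: k => //= k kh; rewrite nxtE runs_left; lia. Qed.

Lemma runs_right0 c k : k <= h -> runs None (traject nxr c k).
Proof. by case: k => //= k kh; rewrite /nxr runs_right; lia. Qed.

Lemma state_runs_inj s1 s2 : valid s1 -> valid s2 ->
  (forall z, runs None z -> runs s1 z = runs s2 z) -> s1 = s2.
Proof.
move=> V1 V2 R.
have D y : desc s1 y = desc s2 y.
  by apply/negb_inj; have := R [:: y] isT; rewrite /= !andbT.
case: s1 s2 V1 V2 R D => [[[d1 i1] j1]|] [[[d2 i2] j2]|] //= V1 V2 R D.
- have {}D : d1 = d2.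
    (* Otherwise [d1] and [d2] would each be [rho] of the other, against [rho2']. *)
    have := D d1; have := D d2; rewrite !eqxx /=.
    have [//|N] := eqVneq d1 d2 => /=.
    by move=> /andP[_ /eqP ->] /esym/andP[_]; rewrite rho2'.
  subst d2.
  have i12 : i1 = i2.
    apply/eqP; rewrite eqn_leq.
    have := R _ (runs_left0 (rhoi d1) (leq_subr i1 h)).
    have := R _ (runs_left0 (rhoi d1) (leq_subr i2 h)).
    rewrite !runs_left; lia.
  have j12 : j1 = j2.
    apply/eqP; rewrite eqn_leq.
    have := R _ (runs_right0 (rho d1) (leq_subr j1 h)).
    have := R _ (runs_right0 (rho d1) (leq_subr j2 h)).
    rewrite !runs_right; lia.
  by rewrite i12 j12.
- by have := D d1; rewrite eqxx.
- by have := D d2; rewrite eqxx.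
Qed.

Lemma same_cone_inv x1 x2 v1 v2 : walk [::] x1 v1 -> walk [::] x2 v2 ->
  same_cone x1 x2 -> vtype v1 = vtype v2.
Proof.
move=> W1 W2 C; have [_ n1] := walk_normal hg W1; have [_ n2] := walk_normal hg W2.
apply: state_runs_inj; rewrite ?valid_vtype // => z r.
apply/idP/idP; first by move=> /(in_cone_runs W1 r)/C/(in_cone_runs W2 r).
by move=> /(in_cone_runs W2 r)/C/(in_cone_runs W1 r).
Qed.

Lemma walk_rev z : normal (rev z) -> walk [::] z (rev z).
Proof. by rewrite -[rev z]cats0; apply: walk_tree. Qed.

Lemma cone_distinct_uniq (l : seq word) : all (fun z => normal (rev z)) l ->
  uniq [seq vtype (rev z) | z <- l] -> cone_distinct l.
Proof.
move=> /allP nl ul i j il jl C.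
have W n : n < size l -> walk [::] (nth [::] l n) (rev (nth [::] l n)).
  by move=> nlt; apply/walk_rev/nl/mem_nth.
have := same_cone_inv (W _ il) (W _ jl) C.
rewrite -!(nth_map [::] None (fun z => vtype (rev z))) //.
by move/eqP; rewrite nth_uniq ?size_map // => /eqP.
Qed.

(** * Pieces of the relator *)

Lemma traject_infix (T : eqType) (f : T -> T) a n (p z q : seq T) :
  traject f a n = p ++ z ++ q -> z = traject f (iter (size p) f a) (size z).
Proof.
move=> E; have := congr1 size E; rewrite size_traject !size_cat => nE.
move: E; rewrite nE !trajectD => /eqP.
by rewrite !eqseq_cat ?size_traject // => /and3P[_ /eqP <-]; rewrite size_traject.
Qed.

Lemma infix_traject (T : eqType) (f : T -> T) a i n :
  i <= n -> infix (traject f a i) (traject f a n).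
Proof. by move=> /subnKC <-; rewrite trajectD; apply/prefixW/prefix_prefix. Qed.

Lemma winv_relator :
  winv (relator g) = traject nxr (linv (iter (4 * g).-1 nxt (a0 hg))) (4 * g).
Proof. by rewrite (relatorE hg) winv_traject. Qed.

Lemma iter_nxr_period c : iter (4 * g) nxr c = c.
Proof.
rewrite -[c in iter _ _ c]linvK iter_nxr -{1}[linv c]iter_nxt_period.
by rewrite iter_nxtK linvK.
Qed.

(** Rotations of the relator start at every letter, so candidates are the arcs of length at most [h]
    in either direction. *)
Lemma candidateP z : candidate z <-> 0 < size z <= h /\
  exists c, z = traject nxt c (size z) \/ z = traject nxr c (size z).
Proof.
split=> -[sz].
  move=> [k [kg]]; rewrite winv_relator (relatorE hg).
  rewrite !rot_traject; try lia; last 2 first.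
  - exact: iter_nxr_period.
  - exact: iter_nxt_period.
  by case=> /infixP[p [q /traject_infix E]]; split=> //; eexists; [left|right]; exact: E.
move=> [c E]; split=> //; case: E => ->.
  have [k kg <-] := letter_iter hg (a0 hg) c.
  exists k; split=> //; left; rewrite (relatorE hg) rot_traject; first last.
  - exact: iter_nxt_period.
  - lia.
  by apply: infix_traject; lia.
have [k kg E] := letter_iter hg (linv c) (iter (4 * g).-1 nxt (a0 hg)).
exists k; split=> //; right; rewrite winv_relator rot_traject; first last.
- exact: iter_nxr_period.
- lia.
rewrite iter_nxr -E iter_nxtK linvK.
by apply: infix_traject; lia.
Qed.

(** * Representatives of the cone types *)

Definition left_word c i : word := traject nxt c i.
Definition right_word c j : word := traject nxr c j.

Lemma vtype_left_word c i : 0 < i < h ->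
  normal (rev (left_word c i)) /\
  vtype (rev (left_word c i)) = Some (linv (iter i.-1 nxt c), i, 1).
Proof.
move=> ih; have [nz [j [sz jE]]] := left_chain hg (B := [::]) (c := c) isT isT ih.
rewrite /left_word; rewrite cats0 in nz sz; split=> //; rewrite sz.
have [i1|i1] := eqVneq i 1; last by rewrite jE //; lia.
by subst i; move: sz => /= [<-].
Qed.

Lemma vtype_right_word c j : 1 < j <= h ->
  normal (rev (right_word c j)) /\
  vtype (rev (right_word c j)) = Some (linv (iter j.-1 nxr c), 1, j).
Proof.
case: j => // j jh; rewrite /right_word /= rev_cons -cats1.
by have [|||nz ->] := right_chain hg (u := [:: c]) (y := c) (n := j); rewrite //= ?eqxx; lia.
Qed.

(** Single letters are listed only as left words, and half polygons only as right words because the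
    two halves agree in the group. This leaves [h - 1] lengths for each letter and direction. *)
Definition cone_words : seq word :=
  [seq left_word c i | c <- enum letter, i <- iota 1 (h - 1)] ++
  [seq right_word c j | c <- enum letter, j <- iota 2 (h - 1)].

Lemma cone_wordsP z : reflect
  (exists c n, (0 < n < h /\ z = left_word c n) \/ (1 < n <= h /\ z = right_word c n))
  (z \in cone_words).
Proof.
rewrite mem_cat; apply: (iffP orP) => [[]/allpairsP[[c n] /= [_]]|[c [n]]].
- by rewrite mem_iota => ? ->; exists c, n; left; split=> //; lia.
- by rewrite mem_iota => ? ->; exists c, n; right; split=> //; lia.
case=> [] [nh ->]; [left|right]; apply/allpairsP; exists (c, n);
by rewrite /= mem_enum mem_iota; split=> //; lia.
Qed.

Lemma size_cone_words : size cone_words = 8 * g * (2 * g - 1).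
Proof.
rewrite size_cat !size_allpairs !size_iota -!cardE !card_prod !card_bool card_ord.
by rewrite -mulnDl; congr (_ * _); lia.
Qed.

Lemma normal_cone_words z : z \in cone_words -> normal (rev z) /\ vtype (rev z) != None.
Proof.
by case/cone_wordsP => [c [n [][nh ->]]];
  [have [? ->] := vtype_left_word c nh | have [? ->] := vtype_right_word c nh].
Qed.

Lemma state_inj d1 i1 j1 d2 i2 j2 : Some (d1, i1, j1) = Some (d2, i2, j2) :> state g ->
  [/\ d1 = d2, i1 = i2 & j1 = j2].
Proof. by move=> [-> -> ->]. Qed.

Lemma uniq_cone_words : uniq [seq vtype (rev z) | z <- cone_words].
Proof.
rewrite map_inj_in_uniq; last first.
  move=> z1 z2 /cone_wordsP[c1 [n1 E1]] /cone_wordsP[c2 [n2 E2]].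
  case: E1 E2 => [[n1h ->]|[n1h ->]] [[n2h ->]|[n2h ->]].
  - have [_ ->] := vtype_left_word c1 n1h; have [_ ->] := vtype_left_word c2 n2h.
    move=> /state_inj[/linv_inj E En _]; subst n2.
    by move/(congr1 (iter n1.-1 (@prv g))): E; rewrite !iter_nxtK => ->.
  - have [_ ->] := vtype_left_word c1 n1h; have [_ ->] := vtype_right_word c2 n2h.
    by move=> /state_inj[_ _ E]; lia.
  - have [_ ->] := vtype_right_word c1 n1h; have [_ ->] := vtype_left_word c2 n2h.
    by move=> /state_inj[_ _ E]; lia.
  - have [_ ->] := vtype_right_word c1 n1h; have [_ ->] := vtype_right_word c2 n2h.
    move=> /state_inj[/linv_inj E _ En]; subst n2.
    move: E; rewrite -[c1]linvK -[c2]linvK !iter_nxr => /linv_inj.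
    by move/(congr1 (iter n1.-1 nxt)); rewrite !iter_prvK => ->.
(* It remains that the words are distinct: length and first letter separate each family, the right
   height separates the two families. *)
rewrite cat_uniq; apply/and3P; split.
- apply: allpairs_uniq; rewrite ?enum_uniq ?iota_uniq // => -[c1 i1] [c2 i2] /=.
  move=> /allpairsP[[c3 i3] /= [_ i3h [-> ->]]] /allpairsP[[c4 i4] /= [_ i4h [-> ->]]].
  move: i3h i4h; rewrite !mem_iota /left_word => i3h i4h E.
  have E' := congr1 size E; rewrite !size_traject in E'; subst i4.
  by move: E i3h; case: i3 {i4h} => //= i3 [-> _].
- apply/hasPn => z /allpairsP[[c j] /= [_ jh ->]].
  apply/negP => /allpairsP[[d i] /= [_ ih E]].
  move: jh ih; rewrite !mem_iota => jh ih.
  have [|_ E1] := @vtype_right_word c j; first lia.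
  have [|_ E2] := @vtype_left_word d i; first lia.
  by move: E1; rewrite E E2 => /state_inj[_ _ j1]; lia.
- apply: allpairs_uniq; rewrite ?enum_uniq ?iota_uniq // => -[c1 i1] [c2 i2] /=.
  move=> /allpairsP[[c3 i3] /= [_ i3h [-> ->]]] /allpairsP[[c4 i4] /= [_ i4h [-> ->]]].
  move: i3h i4h; rewrite !mem_iota /right_word => i3h i4h E.
  have E' := congr1 size E; rewrite !size_traject in E'; subst i4.
  by move: E i3h; case: i3 {i4h} => //= i3 [-> _].
Qed.

Lemma cone_words_candidate z : z \in cone_words -> candidate z.
Proof.
by case/cone_wordsP=> [c [n [][nh ->]]]; apply/candidateP;
  rewrite /left_word /right_word size_traject; (split; first lia); exists c; [left|right].
Qed.

Lemma candidate_cone_words z : candidate z -> exists2 y, y \in cone_words & same_cone z y.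
Proof.
move=> /candidateP[]; set n := size z => zh [c E].
have left_case d : exists2 y, y \in cone_words & same_cone (traject nxt d n) y.
  have [nh|nh] := ltnP n h.
    exists (left_word d n) => //; apply/cone_wordsP; exists d, n; left; split=> //; lia.
  have {nh} -> : n = h by lia.
  exists (right_word (rho d) h); last exact/same_cone_eqw/eqw_half.
  by apply/cone_wordsP; exists (rho d), h; right; split=> //; lia.
case: E => ->; first exact: left_case.
have [n1|n1] := ltnP 1 n.
  by exists (right_word c n) => //; apply/cone_wordsP; exists c, n; right; split=> //; lia.
have nE : n = 1 by lia.
by have := left_case c; rewrite nE.
Qed.

(** By [valid], a type other than [None] has [j = 1] or [i = 1]; going back along the polygon from
    [d] gives the first letter of a word with that type. *)
Lemma cone_words_complete u : ~ eqw u [::] ->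
  exists2 y, y \in cone_words & same_cone u y.
Proof.
move=> N; have [v W] := walk_exists hg u (isT : normal ([::] : word)).
have [_ nv] := walk_normal hg W; have V := valid_vtype hg nv.
suff [y yin yE] : exists2 y, y \in cone_words & vtype (rev y) = vtype v.
  exists y => //; apply: same_cone_vtype W _ (esym yE).
  by apply: walk_rev; case: (normal_cone_words yin).
case sv: (vtype v) V => [[[d i] j]|] /= V; last first.
  case: v W nv sv => [W|y v W /andP[nv T]] /=; last first.
    by have [i [j ->]] := delta_tree T.
  by move=> _ _; case: N; exact: walk_sound W.
have [j1|j1] := eqVneq j 1.
  have ih : 0 < i < h by lia.
  exists (left_word (iter i.-1 (@prv g) (linv d)) i).
    by apply/cone_wordsP; eexists _, i; left; split.
  by have [_ ->] := vtype_left_word (iter i.-1 (@prv g) (linv d)) ih; rewrite iter_prvK linvK j1.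
have jh : 1 < j <= h by lia.
exists (right_word (linv (iter j.-1 nxt d)) j).
  by apply/cone_wordsP; eexists _, j; right; split.
have [_ ->] := vtype_right_word (linv (iter j.-1 nxt d)) jh.
by rewrite iter_nxr iter_nxtK linvK (_ : i = 1) //; lia.
Qed.
End Cones.

(** * Covering by candidates and the two counts *)

Theorem theorem3p7 (g : nat) (hg : 2 <= g) :
  (forall x : word g, ~ eqw x [::] -> exists z, candidate z /\ same_cone x z) /\
  (exists s : seq (word g),
      size s = 8 * g * (2 * g - 1) /\ (forall z, z \in s -> candidate z) /\
      cone_distinct s /\
      (forall z, candidate z -> exists2 y, y \in s & same_cone z y)) /\
  (exists s : seq (word g),
      size s = 8 * g * (2 * g - 1) + 1 /\ cone_distinct s /\
      (forall x : word g, exists2 y, y \in s & same_cone x y)).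
Proof.
have normal_all : all (fun z => normal (rev z)) (cone_words g).
  by apply/allP => z /(normal_cone_words hg)[].
split; [|split].
- move=> x /(cone_words_complete hg)[z zin C]; exists z; split=> //.
  exact: cone_words_candidate hg _ zin.
- exists (cone_words g); split; first exact: size_cone_words.
  split; first by move=> z; exact: cone_words_candidate.
  split; first exact: cone_distinct_uniq (uniq_cone_words hg).
  by move=> z; exact: candidate_cone_words.
- exists ([::] :: cone_words g); split; first by rewrite [RHS]addn1 -(size_cone_words hg).
  split.
    apply: cone_distinct_uniq; rewrite //= uniq_cone_words // andbT.
    by apply/mapP => -[z /(normal_cone_words hg)[_ /eqP N] /esym].
  move=> x; have [E|N] := excluded_middle_informative (eqw x [::]).
    by exists [::]; [rewrite inE eqxx | exact: same_cone_eqw].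
  have [y yin C] := cone_words_complete hg N.
  by exists y; rewrite // inE yin orbT.
Qed.
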